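(* If a translation surface $S$ is algebraically periodic with periodic direction field $K$, then the group $\mathrm{Iso}(J(S))$ is conjugate (by an element of $GL(2,\mathbb{R})$) to $SL(2,K)$.
   Context: A translation surface is a compact (connected, oriented) surface $S$ obtained by gluing finitely many polygons in $\mathbb{R}^2$ along parallel edges by translations. View $\mathbb{R}^2$ and $\mathbb{R}$ as $\mathbb{Q}$-vector spaces. Take an edge-to-edge decomposition of $S$ into Euclidean triangles $\Delta_j$ whose vertex set contains the singular points, and let $v_j,w_j\in\mathbb{R}^2$ be two successive sides of $\Delta_j$ in counterclockwise order. The $J$-invariant is $J(S)=\sum_j v_j\wedge w_j\in\mathbb{R}^2\wedge_{\mathbb{Q}}\mathbb{R}^2$ (independent of the triangulation). $\mathrm{Iso}(J(S))$ is the group of $\alpha\in SL(2,\mathbb{R})$ that fix $J(S)$ under the induced action $v\wedge w\mapsto \alpha v\wedge\alpha w$ on $\mathbb{R}^2\wedge_{\mathbb{Q}}\mathbb{R}^2$. For $0\ne v\in\mathbb{R}^2$ let $\pi:\mathbb{R}^2\to\mathbb{R}$ be the orthogonal projection with kernel $\mathbb{R}v$, and let $\mathrm{SAF}_v(S)\in\mathbb{R}\wedge_{\mathbb{Q}}\mathbb{R}$ be the image of $J(S)$ under the map induced by $\pi$. The direction $v$ is algebraically periodic if $\mathrm{SAF}_v(S)=0$. $S$ is algebraically periodic if it has at least three algebraically periodic directions. In that case, after a linear change of coordinates so that the directions of slopes $0,1,\infty$ are algebraically periodic, the set of finite slopes of algebraically periodic directions is a subfield $K$ of $\mathbb{R}$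 (independent of the choices), called the periodic direction field of $S$. *)

(* Defs.v *)
From HB Require Import structures.
From mathcomp Require Import all_boot all_order all_algebra.
From mathcomp Require Import generic_quotient.
From mathcomp Require Import ring.
From mathcomp Require Import all_classical all_reals all_analysis.

Set Implicit Arguments.
Unset Strict Implicit.
Unset Printing Implicit Defensive.

Import Order.TTheory GRing.Theory Num.Theory.
Import numFieldNormedType.Exports.

Local Open Scope classical_set_scope.
Local Open Scope ring_scope.

(* The exterior square over Q of a vector space V over R, V being seen as a
   Q-vector space through ratr : rat -> R.  A formal sum of wedges is a list of
   pairs; rational coefficients are not needed since q (v /\ w) = (q v) /\ w. *)
Section ExteriorSquare.
Local Open Scope quotient_scope.
Context {R : numFieldType} (V : lmodType R).
Implicit Types (s t : seq (V * V)) (u v w : V).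

Inductive ext2_eq : seq (V * V) -> seq (V * V) -> Prop :=
| Ext2Refl s : ext2_eq s s
| Ext2Sym s t : ext2_eq s t -> ext2_eq t s
| Ext2Trans s t r : ext2_eq s t -> ext2_eq t r -> ext2_eq s r
| Ext2Cat s s' t t' : ext2_eq s s' -> ext2_eq t t' -> ext2_eq (s ++ t) (s' ++ t')
| Ext2CatC s t : ext2_eq (s ++ t) (t ++ s)
| Ext2Dl u v w : ext2_eq [:: (u + v, w)] [:: (u, w); (v, w)]
| Ext2Dr u v w : ext2_eq [:: (u, v + w)] [:: (u, v); (u, w)]
| Ext2Z (q : rat) u v : ext2_eq [:: (ratr q *: u, v)] [:: (u, ratr q *: v)]
| Ext2Alt v : ext2_eq [:: (v, v)] [::].

Let eqb s t := `[< ext2_eq s t >].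

Let eqb_refl : reflexive eqb.
Proof. by move=> s; apply/asboolP; exact: Ext2Refl. Qed.

Let eqb_sym : symmetric eqb.
Proof. by move=> s t; apply/asboolP/asboolP => /Ext2Sym. Qed.

Let eqb_trans : transitive eqb.
Proof.
by move=> t s r /asboolP st /asboolP tr; apply/asboolP; exact: Ext2Trans st tr.
Qed.

Definition ext2_rel := EquivRel eqb eqb_refl eqb_sym eqb_trans.

Definition ext2 := {eq_quot ext2_rel}.

HB.instance Definition _ := Choice.on ext2.
HB.instance Definition _ := EqQuotient.on ext2.

Lemma ext2_piP s t : \pi_ext2 s = \pi_ext2 t <-> ext2_eq s t.
Proof. by split=> [/eqquotP/asboolP|st]; last exact/eqquotP/asboolP. Qed.

Lemma ext2_reprP s : ext2_eq (repr (\pi_ext2 s)) s.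
Proof. by apply/ext2_piP; rewrite reprK. Qed.

Definition ext2_0 : ext2 := \pi_ext2 [::].
Definition ext2_add (x y : ext2) : ext2 := \pi_ext2 (repr x ++ repr y).
Definition ext2_opp (x : ext2) : ext2 :=
  \pi_ext2 [seq (- p.1, p.2) | p <- repr x].

Lemma ext2_pi_cat s t : ext2_add (\pi_ext2 s) (\pi_ext2 t) = \pi_ext2 (s ++ t).
Proof. by apply/ext2_piP; apply: Ext2Cat; exact: ext2_reprP. Qed.

Let addC : commutative ext2_add.
Proof. by move=> x y; apply/ext2_piP; exact: Ext2CatC. Qed.

Let addA : associative ext2_add.
Proof.
elim/quotW=> x; elim/quotW=> y; elim/quotW=> z.
by rewrite (ext2_pi_cat y z) (ext2_pi_cat x y) !ext2_pi_cat catA.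
Qed.

Let add0 : left_id ext2_0 ext2_add.
Proof. by elim/quotW=> x; rewrite ext2_pi_cat. Qed.

Lemma ext2_eq0l w : ext2_eq [:: (0, w)] [::].
Proof.
have := @Ext2Z 0 0 w; rewrite rmorph0 !scale0r => h.
exact: Ext2Trans h (Ext2Alt 0).
Qed.

Let addN : left_inverse ext2_0 ext2_opp ext2_add.
Proof.
move=> x; rewrite -[X in ext2_add _ X]reprK ext2_pi_cat.
apply/ext2_piP; elim: (repr x) => [|[u v] s IHs] /=; first exact: Ext2Refl.
set s' := [seq _ | p <- s].
apply: (@Ext2Trans _ ([:: (- u, v); (u, v)] ++ (s' ++ s))).
  have h : ext2_eq ([:: (- u, v)] ++ ((s' ++ [:: (u, v)]) ++ s))
      ([:: (- u, v)] ++ (([:: (u, v)] ++ s') ++ s)).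
    apply: Ext2Cat; first exact: Ext2Refl.
    by apply: Ext2Cat; [exact: Ext2CatC|exact: Ext2Refl].
  by rewrite -catA in h.
rewrite -[X in ext2_eq _ X]/([::] ++ [::]); apply: Ext2Cat; last exact: IHs.
apply: Ext2Trans (Ext2Sym (Ext2Dl _ _ _)) _.
by rewrite addNr; exact: ext2_eq0l.
Qed.

HB.instance Definition _ := GRing.isZmodule.Build ext2 addA addC add0 addN.

Definition wedge2 v w : ext2 := \pi_ext2 [:: (v, w)].

Lemma ext2_pi_sum s : \pi_ext2 s = \sum_(p <- s) wedge2 p.1 p.2.
Proof.
elim: s => [|[u v] s IHs]; first by rewrite big_nil.
by rewrite big_cons -IHs [RHS]ext2_pi_cat.
Qed.

Definition ext2_lift (W : zmodType) (b : V -> V -> W) (x : ext2) : W :=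
  \sum_(p <- repr x) b p.1 p.2.

Section Lift.
Context (W : zmodType) (b : V -> V -> W).
Hypothesis bDl : forall u v w, b (u + v) w = b u w + b v w.
Hypothesis bDr : forall u v w, b u (v + w) = b u v + b u w.
Hypothesis bZ : forall (q : rat) u v, b (ratr q *: u) v = b u (ratr q *: v).
Hypothesis balt : forall v, b v v = 0.

Lemma ext2_lift_pi s : ext2_lift b (\pi_ext2 s) = \sum_(p <- s) b p.1 p.2.
Proof.
rewrite /ext2_lift; have := ext2_reprP s.
move: (repr _) => t; elim: t s / => [//|//|? ? ? _ -> _ -> //|s s' t t' _ e _ e'|s t
  |u v w|u v w|q u v|v].
- by rewrite !big_cat /= e e'.
- by rewrite !big_cat /= addrC.
- by rewrite !big_cons !big_nil !addr0 bDl.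
- by rewrite !big_cons !big_nil !addr0 bDr.
- by rewrite !big_cons !big_nil !addr0 bZ.
- by rewrite big_cons !big_nil addr0 balt.
Qed.

Lemma ext2_liftE v w : ext2_lift b (wedge2 v w) = b v w.
Proof. by rewrite ext2_lift_pi big_cons big_nil addr0. Qed.

Lemma ext2_liftD : {morph ext2_lift b : x y / x + y}.
Proof.
elim/quotW=> x; elim/quotW=> y; rewrite [X in ext2_lift b X]ext2_pi_cat.
by rewrite !ext2_lift_pi big_cat.
Qed.

End Lift.

Lemma wedge2Dl u v w : wedge2 (u + v) w = wedge2 u w + wedge2 v w.
Proof. by rewrite [RHS]ext2_pi_cat; apply/ext2_piP; exact: Ext2Dl. Qed.

Lemma wedge2Dr u v w : wedge2 u (v + w) = wedge2 u v + wedge2 u w.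
Proof. by rewrite [RHS]ext2_pi_cat; apply/ext2_piP; exact: Ext2Dr. Qed.

Lemma wedge2Z (q : rat) u v : wedge2 (ratr q *: u) v = wedge2 u (ratr q *: v).
Proof. by apply/ext2_piP; exact: Ext2Z. Qed.

Lemma wedge2vv v : wedge2 v v = 0.
Proof. by apply/ext2_piP; exact: Ext2Alt. Qed.

End ExteriorSquare.

Definition ext2_map {R : numFieldType} {V W : lmodType R}
    (f : {linear V -> W}) : ext2 V -> ext2 W :=
  ext2_lift (fun v w => wedge2 (f v) (f w)).

Section Ext2Map.
Context {R : numFieldType} {V W : lmodType R} (f : {linear V -> W}).

Lemma ext2_map_wedge v w : ext2_map f (wedge2 v w) = wedge2 (f v) (f w).
Proof.
apply: ext2_liftE => [u v' w'|u v' w'|q u v'|u].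
- by rewrite linearD wedge2Dl.
- by rewrite linearD wedge2Dr.
- by rewrite !linearZ /= wedge2Z.
- exact: wedge2vv.
Qed.

Lemma ext2_mapD : {morph ext2_map f : x y / x + y}.
Proof.
apply: ext2_liftD => [u v' w'|u v' w'|q u v'|u].
- by rewrite linearD wedge2Dl.
- by rewrite linearD wedge2Dr.
- by rewrite !linearZ /= wedge2Z.
- exact: wedge2vv.
Qed.

End Ext2Map.

(* A polygon is the list of its vertices; indices are read modulo the number of
   sides, and side k goes from vertex k to vertex k + 1. *)
Section Polygons.
Context {R : realType}.
Implicit Types (P : seq 'cV[R]_2) (k : nat).

Definition vtx P k : 'cV[R]_2 := nth 0 P (k %% size P)%N.

Definition side P k : 'cV[R]_2 := vtx P k.+1 - vtx P k.

Definition on_side P k (x : 'cV[R]_2) : Prop :=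
  exists2 t : R, 0 <= t <= 1 & x = vtx P k + t *: side P k.

Definition boundary P : set 'cV[R]_2 :=
  [set x | exists2 k, (k < size P)%N & on_side P k x].

(* The closed region bounded by P: the boundary together with the bounded
   components of its complement. *)
Definition region P : set 'cV[R]_2 :=
  boundary P `|` [set x | bounded_set (connected_component (~` boundary P) x)].

(* The closed polygonal curve has no self-intersection. *)
Definition simple_polygon P : Prop :=
  forall j k (s t : R), (j < size P)%N -> (k < size P)%N ->
    0 <= s < 1 -> 0 <= t < 1 ->
    vtx P j + s *: side P j = vtx P k + t *: side P k -> j = k /\ s = t.

Definition signed_area P : R :=
  2%:R^-1 * \sum_(k < size P) \det (row_mx (vtx P k) (vtx P k.+1)).

Definition is_polygon P : Prop :=
  [/\ (3 <= size P)%N, simple_polygon P & 0 < signed_area P].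

End Polygons.

(* Finitely many counterclockwise polygons with their sides paired.  Paired
   sides are opposite vectors, so they are glued by a translation and the
   polygons lie on the two different sides of the common edge. *)
Record polygon_gluing (R : realType) := PolygonGluing {
  piece : finType;
  poly : piece -> seq 'cV[R]_2;
  mate : piece * nat -> piece * nat;
  polyP : forall i, is_polygon (poly i);
  mate_side : forall i k, (k < size (poly i))%N ->
    ((mate (i, k)).2 < size (poly (mate (i, k)).1))%N;
  mateK : forall i k, (k < size (poly i))%N -> mate (mate (i, k)) = (i, k);
  mate_opp : forall i k, (k < size (poly i))%N ->
    side (poly (mate (i, k)).1) (mate (i, k)).2 = - side (poly i) k
}.

(* The equivalence relation on the disjoint union of the polygons which
   generates the gluing; symmetric because mate is an involution. *)
Inductive glued (R : realType) (G : polygon_gluing R) :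
    piece G * 'cV[R]_2 -> piece G * 'cV[R]_2 -> Prop :=
| GluedRefl p : glued p p
| GluedStep i k x q : (k < size (poly i))%N -> on_side (poly i) k x ->
    glued ((mate (i, k)).1,
           x + (vtx (poly (mate (i, k)).1) (mate (i, k)).2.+1 - vtx (poly i) k))
          q ->
    glued (i, x) q.

(* X is the surface obtained from the polygons: chart i maps the i-th polygon
   to X.  As the polygons are compact, for Hausdorff X this says that X is the
   quotient space of the disjoint union of the polygons by the gluing. *)
Record gluing_of (R : realType) (X : topologicalType) := GluingOf {
  pieces :> polygon_gluing R;
  chart : piece pieces -> 'cV[R]_2 -> X;
  chart_cont : forall i, {within region (poly i), continuous (chart i)};
  chart_surj : forall x : X, exists i, exists2 y, region (poly i) y & chart i y = x;
  chart_eq : forall i j x y, region (poly i) x -> region (poly j) y ->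
    chart i x = chart j y <-> glued (i, x) (j, y)
}.

(* The coordinates given by two decompositions of X into polygons differ by
   translations. *)
Definition same_translation_structure (R : realType) (X : topologicalType)
    (G H : gluing_of R X) : Prop :=
  forall (i : piece G) (j : piece H) (x y : 'cV[R]_2),
    interior (region (poly i)) x -> interior (region (poly j)) y ->
    chart i x = chart j y ->
    \forall h \near (0 : 'cV[R]_2), chart i (x + h) = chart j (y + h).

(* Compactness follows from the field polygons. *)
Record translation_surface (R : realType) := TranslationSurface {
  surface :> topologicalType;
  surface_hausdorff : hausdorff_space surface;
  surface_nonempty : [set: surface] !=set0;
  surface_connected : connected [set: surface];
  polygons : gluing_of R surface
}.

(* An edge-to-edge decomposition into Euclidean triangles.  Singular points are
   vertices, because away from its vertices a gluing of triangles is locally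
   isometric to the plane. *)
Record triangulation (R : realType) (S : translation_surface R) :=
  Triangulation {
  triangles :> gluing_of R S;
  triangleP : forall j : piece triangles, size (poly j) = 3%N;
  triangles_translation : same_translation_structure triangles (polygons S)
}.

Definition J_invariant (R : realType) (S : translation_surface R)
    (T : triangulation S) : ext2 'cV[R]_2 :=
  \sum_(j : piece T) wedge2 (side (poly j) 0%N) (side (poly j) 1%N).

Section AlgebraicallyPeriodic.
Context {R : realType}.
Implicit Types (J : ext2 'cV[R]_2) (u v w : 'cV[R]_2).

Definition SL2 (K : set R) : set 'M[R]_2 :=
  [set A : 'M[R]_2 | (forall i j, K (A i j)) /\ \det A = 1].

Definition Iso J : set 'M[R]_2 :=
  [set A : 'M[R]_2 | SL2 setT A /\ ext2_map (mulmx A) J = J].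

(* Orthogonal projection with kernel R v, the orthogonal complement of R v being
   identified with R by the unit vector (- v_1, v_0) / |v|. *)
Definition perp_proj v (x : 'cV[R]_2) : R^o :=
  (v 0 0 * x 1 0 - v 1 0 * x 0 0) / Num.sqrt (v 0 0 ^+ 2 + v 1 0 ^+ 2).

Lemma perp_proj_is_linear v : linear (perp_proj v).
Proof.
move=> a x y; rewrite /perp_proj !mxE -[a *: _]/(a * _).
by rewrite mulrA -mulrDl; congr (_ / _); ring.
Qed.

HB.instance Definition _ v :=
  GRing.isLinear.Build R 'cV[R]_2 R^o *:%R (perp_proj v)
    (perp_proj_is_linear v).

Definition SAF J v : ext2 R^o := ext2_map (perp_proj v) J.

Definition periodic_direction J v : Prop := v != 0 /\ SAF J v = 0.

Definition parallel u v : Prop := \det (row_mx u v) = 0.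

(* v and c *: v represent the same direction. *)
Definition algebraically_periodic J : Prop :=
  exists u v w,
    [/\ periodic_direction J u, periodic_direction J v & periodic_direction J w]
    /\ [/\ ~ parallel u v, ~ parallel u w & ~ parallel v w].

Definition slope_vec (l : R) : 'cV[R]_2 := \col_i [:: 1; l]`_i.
Definition vertical_vec : 'cV[R]_2 := \col_i [:: 0; 1]`_i.

(* In the linear coordinates x |-> g *m x, the vectors of slope l are the
   multiples of invmx g *m slope_vec l. *)
Definition periodic_slopes J (g : 'M[R]_2) : set R :=
  [set l | periodic_direction J (invmx g *m slope_vec l)].

Definition normalizes J (g : 'M[R]_2) : Prop :=
  [/\ g \in unitmx, periodic_slopes J g 0, periodic_slopes J g 1
    & periodic_direction J (invmx g *m vertical_vec)].

Definition is_periodic_direction_field J (K : set R) : Prop :=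
  exists2 g : 'M[R]_2, normalizes J g & K = periodic_slopes J g.

End AlgebraicallyPeriodic.

(* Main.v *)
Require Import Defs.
From HB Require Import structures.
From mathcomp Require Import all_boot all_order all_algebra.
From mathcomp Require Import generic_quotient ring.
From mathcomp Require Import all_classical all_reals all_analysis.

Local Open Scope classical_set_scope.
Local Open Scope ring_scope.

(* In coordinates where the slopes 0, 1 and infinity are periodic, J is a sum
   of terms (x, 0) /\ (0, y), i.e. a symmetric tensor t in R (x) R, and l is a
   periodic slope iff (l (x) 1) t = (1 (x) l) t.  This makes the set K of
   periodic slopes a field whose shears fix J; the LDU decomposition then gives
   SL2 K inside Iso J.  Conversely, Iso J permutes the periodic directions, so
   LDU reduces a matrix of Iso J modulo SL2 K to diag (a, 1/a), and
   (a (x) 1/a) t = t forces a \in K. *)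

Import Order.TTheory GRing.Theory Num.Theory.

Set Implicit Arguments.
Unset Strict Implicit.
Unset Printing Implicit Defensive.

(** * Exterior squares over Q: functoriality and absence of 2-torsion *)

Section ExteriorSquareTheory.
Context {R : numFieldType}.
Implicit Types U V W : lmodType R.

(** Wedges generate the exterior square as an abelian group, rational coefficients being absorbed
    into a factor. *)
Lemma ext2_eq_additive V (A : zmodType) (F G : ext2 V -> A) :
    {morph F : x y / x + y} -> {morph G : x y / x + y} ->
    (forall u v, F (wedge2 u v) = G (wedge2 u v)) ->
  F =1 G.
Proof.
move=> FD GD FG; elim/quotW=> s; rewrite ext2_pi_sum.
have m0 (H : ext2 V -> A) : {morph H : x y / x + y} -> H 0 = 0.
  by move=> HD; apply: (addrI (H 0)); rewrite -HD !addr0.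
by elim: s => [|p s IHs]; rewrite ?big_nil ?m0 // big_cons FD GD IHs FG.
Qed.

Lemma wedge20l V (v : V) : wedge2 0 v = 0.
Proof. by apply/ext2_piP; exact: ext2_eq0l. Qed.

Lemma wedge2Nl V (u v : V) : wedge2 (- u) v = - wedge2 u v.
Proof.
apply: (addIr (wedge2 u v)); by rewrite -wedge2Dl !addNr wedge20l.
Qed.

Lemma wedge2C V (u v : V) : wedge2 u v = - wedge2 v u.
Proof.
apply/eqP; rewrite -addr_eq0; apply/eqP.
have := wedge2vv (u + v).
by rewrite wedge2Dl !wedge2Dr !wedge2vv add0r addr0.
Qed.

Lemma wedge2Nr V (u v : V) : wedge2 u (- v) = - wedge2 u v.
Proof. by rewrite wedge2C wedge2Nl -wedge2C. Qed.

Lemma wedge20r V (v : V) : wedge2 v 0 = 0.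
Proof. by rewrite wedge2C wedge20l oppr0. Qed.

Lemma ext2_map0 V W (f : {linear V -> W}) : ext2_map f 0 = 0.
Proof. by apply: (addrI (ext2_map f 0)); rewrite -ext2_mapD !addr0. Qed.

Lemma ext2_mapN V W (f : {linear V -> W}) x : ext2_map f (- x) = - ext2_map f x.
Proof. by apply: (addIr (ext2_map f x)); rewrite -ext2_mapD !addNr ext2_map0. Qed.

Lemma ext2_map_comp U V W (f : {linear V -> W}) (h : {linear U -> V})
    (k : {linear U -> W}) :
  (forall x, k x = f (h x)) ->
  forall z, ext2_map f (ext2_map h z) = ext2_map k z.
Proof.
move=> kE; apply: ext2_eq_additive => [x y|x y|u v].
- by rewrite !ext2_mapD.
- by rewrite ext2_mapD.
- by rewrite !ext2_map_wedge !kE.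
Qed.

Lemma ext2_map_id V (f : {linear V -> V}) : f =1 id -> ext2_map f =1 id.
Proof.
move=> fh; apply: ext2_eq_additive; [exact: ext2_mapD|by []|].
by move=> u v; rewrite !ext2_map_wedge !fh.
Qed.

Lemma ext2_map_opp V W (f h : {linear V -> W}) :
  (forall x, f x = - h x) -> ext2_map f =1 ext2_map h.
Proof.
move=> fh; apply: ext2_eq_additive; [exact: ext2_mapD|exact: ext2_mapD|].
by move=> u v; rewrite !ext2_map_wedge !fh wedge2Nl wedge2Nr opprK.
Qed.

(** Scaling both factors by [c] is invertible. This serves to discard normalising factors of
    projections. *)
Lemma ext2_map_scale_eq0 V W (f h : {linear V -> W}) (c : R) z :
  c != 0 -> (forall x, f x = c *: h x) ->
  ext2_map f z = 0 <-> ext2_map h z = 0.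
Proof.
move=> c0 fE; split=> e.
  rewrite -(@ext2_map_comp _ _ _ (GRing.scale c^-1) f) ?e ?ext2_map0 // => x.
  by rewrite /= fE scalerA mulVf // scale1r.
by rewrite -(@ext2_map_comp _ _ _ (GRing.scale c) h) ?e ?ext2_map0.
Qed.

(** Halving the first factor of each wedge gives a well defined additive map, whose double is the
    identity. *)
Lemma ext2_double_eq0 V (z : ext2 V) : z + z = 0 -> z = 0.
Proof.
pose b (u v : V) := wedge2 (ratr 2%:R^-1 *: u) v.
have halfD (v : V) : ratr 2%:R^-1 *: v + ratr 2%:R^-1 *: v = v.
  have half2 : 2%:R^-1 + 2%:R^-1 = 1 :> rat by [].
  by rewrite -scalerDl -rmorphD half2 rmorph1 scale1r.
have bDl u v w : b (u + v) w = b u w + b v w by rewrite /b scalerDr wedge2Dl.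
have bDr u v w : b u (v + w) = b u v + b u w by exact: wedge2Dr.
have bZ (q : rat) u v : b (ratr q *: u) v = b u (ratr q *: v).
  by rewrite /b -wedge2Z !scalerA mulrC.
(* Writing the second factor as v/2 + v/2 leaves only wedges of v/2 with itself. *)
have bvv v : b v v = 0 by rewrite /b -{2}(halfD v) wedge2Dr wedge2vv addr0.
have bD : {morph ext2_lift b : x y / x + y} by exact: ext2_liftD.
have bb x : ext2_lift b x + ext2_lift b x = x.
  have := @ext2_eq_additive V _ (fun x => ext2_lift b x + ext2_lift b x) id.
  apply=> // [{}x y|u v]; first by rewrite bD addrACA.
  by rewrite ext2_liftE // -wedge2Dl halfD.
move=> zz; rewrite -(bb z) -bD zz.
by apply: (addrI (ext2_lift b 0)); rewrite -bD !addr0.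
Qed.

End ExteriorSquareTheory.

(** * Coordinates in the plane and the action of 2 x 2 matrices *)

Section Plane.
Context {R : realType}.
Implicit Types (A B : 'M[R]_2) (u v : 'cV[R]_2) (z : ext2 'cV[R]_2).

Definition vec2 (a b : R) : 'cV[R]_2 := \col_i [:: a; b]`_i.
Definition mat2 (a b c d : R) : 'M[R]_2 :=
  \matrix_(i, j) (nth [::] [:: [:: a; b]; [:: c; d]] i)`_j.

Lemma ord2P (P : 'I_2 -> Prop) : P 0 -> P 1 -> forall i, P i.
Proof.
move=> P0 P1 [[|[|//]] i]; [move: P0|move: P1]; congr P; exact: val_inj.
Qed.

Lemma vec2E v : v = vec2 (v 0 0) (v 1 0).
Proof. by apply/matrixP; apply: ord2P => j; rewrite ord1 !mxE. Qed.

Lemma mat2E A : A = mat2 (A 0 0) (A 0 1) (A 1 0) (A 1 1).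
Proof. by apply/matrixP; apply: ord2P; apply: ord2P; rewrite !mxE. Qed.

Lemma mat2_mul (a b c d a' b' c' d' : R) :
  mat2 a b c d *m mat2 a' b' c' d' =
  mat2 (a * a' + b * c') (a * b' + b * d') (c * a' + d * c') (c * b' + d * d').
Proof.
by apply/matrixP; apply: ord2P; apply: ord2P;
  rewrite !mxE big_ord_recr big_ord1 /= !mxE.
Qed.

Lemma mat2_vec2 (a b c d x y : R) :
  mat2 a b c d *m vec2 x y = vec2 (a * x + b * y) (c * x + d * y).
Proof.
by apply/matrixP; apply: ord2P => j; rewrite ord1 !mxE big_ord_recr big_ord1 /= !mxE.
Qed.

Lemma det_mat2 (a b c d : R) : \det (mat2 a b c d) = a * d - b * c.
Proof.
rewrite (expand_det_row _ 0) big_ord_recr big_ord1 /cofactor !det_mx11 !mxE /=.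
by rewrite expr0 mul1r expr1 mulN1r mulrN.
Qed.

Lemma mat2_1 : mat2 1 0 0 1 = 1%:M.
Proof. by apply/matrixP; apply: ord2P; apply: ord2P; rewrite !mxE. Qed.

Local Notation act A := (ext2_map (mulmx A)).

Lemma actM A B z : act (A *m B) z = act A (act B z).
Proof.
by rewrite (ext2_map_comp (k := mulmx (A *m B))) // => x; rewrite /= mulmxA.
Qed.

Lemma act1 z : act 1%:M z = z.
Proof. by apply: ext2_map_id => x; rewrite /= mul1mx. Qed.

Lemma actK A z : A \in unitmx -> act (invmx A) (act A z) = z.
Proof. by move=> Au; rewrite -actM mulVmx // act1. Qed.

(** * Periodic directions through the determinant form *)

Definition cross v (x : 'cV[R]_2) : R^o := v 0 0 * x 1 0 - v 1 0 * x 0 0.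

Lemma crossE (a b : R) v : cross (vec2 a b) v = a * v 1 0 - b * v 0 0.
Proof. by rewrite /cross !mxE. Qed.

Lemma cross_is_linear v : linear (cross v).
Proof. by move=> a x y; rewrite /cross !mxE -[a *: _]/(a * _); ring. Qed.

HB.instance Definition _ v :=
  GRing.isLinear.Build R 'cV[R]_2 R^o *:%R (cross v) (cross_is_linear v).

Lemma cross_mulmx A u v : cross (A *m u) (A *m v) = \det A * cross u v.
Proof.
rewrite (vec2E u) (vec2E v) (mat2E A) !mat2_vec2 det_mat2 /cross !mxE /=; ring.
Qed.

(** For nonzero [v], [cross v] is [perp_proj v] times the length of [v]; it is preferred because
    matrices transform it by their determinant. *)
Lemma periodic_directionE z v :
  periodic_direction z v <-> v != 0 /\ ext2_map (cross v) z = 0.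
Proof.
have [->|v0] := eqVneq v 0; first by split=> -[/eqP].
have n0 : (Num.sqrt (v 0 0 ^+ 2 + v 1 0 ^+ 2))^-1 != 0.
  rewrite invr_eq0 gt_eqF // sqrtr_gt0 lt0r addr_ge0 ?sqr_ge0 // andbT.
  rewrite paddr_eq0 ?sqr_ge0 // !sqrf_eq0.
  apply: contraNN v0 => /andP[/eqP a /eqP b].
  by rewrite (vec2E v) a b; apply/eqP/matrixP; apply: ord2P => j; rewrite !mxE.
have e := @ext2_map_scale_eq0 _ _ _ (perp_proj v) (cross v) _ z n0.
rewrite /periodic_direction /SAF e ?v0 // => x.
by rewrite /perp_proj -[_ *: _]/(_ * _) mulrC.
Qed.

Lemma periodic_direction_act A z v : A \in unitmx ->
  periodic_direction (act A z) (A *m v) <-> periodic_direction z v.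
Proof.
move=> Au; have d0 : \det A != 0 by rewrite -unitfE -unitmxE.
rewrite !periodic_directionE.
have -> : (A *m v != 0) = (v != 0).
  congr (~~ _); apply/eqP/eqP => [|->]; last exact: mulmx0.
  by move/(congr1 (mulmx (invmx A))); rewrite mulKmx // mulmx0.
have e : forall x, (cross (A *m v) \o mulmx A) x = \det A *: cross v x.
  by move=> x; rewrite /= cross_mulmx.
rewrite (ext2_map_comp (k := cross (A *m v) \o mulmx A)) //.
by rewrite (ext2_map_scale_eq0 _ d0 e).
Qed.

Lemma periodic_directionZ z v (c : R) : c != 0 ->
  periodic_direction z (c *: v) <-> periodic_direction z v.
Proof.
move=> c0; rewrite !periodic_directionE scaler_eq0 negb_or c0 /=.
rewrite (ext2_map_scale_eq0 (h := cross v) _ c0) // => x.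
by rewrite -[RHS]/(c * (v 0 0 * x 1 0 - v 1 0 * x 0 0)) /= /cross !mxE; ring.
Qed.

(** * Splitting of the exterior square along the two axes *)

Definition hvec (x : R^o) : 'cV[R]_2 := vec2 x 0.
Definition vvec (x : R^o) : 'cV[R]_2 := vec2 0 x.

Lemma hvec_is_linear : linear hvec.
Proof.
move=> a x y; apply/matrixP; apply: ord2P => j; rewrite !mxE //=.
by rewrite mulr0 addr0.
Qed.

Lemma vvec_is_linear : linear vvec.
Proof.
move=> a x y; apply/matrixP; apply: ord2P => j; rewrite !mxE //=.
by rewrite mulr0 addr0.
Qed.

HB.instance Definition _ :=
  GRing.isLinear.Build R R^o 'cV[R]_2 *:%R hvec hvec_is_linear.
HB.instance Definition _ :=
  GRing.isLinear.Build R R^o 'cV[R]_2 *:%R vvec vvec_is_linear.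

(* The span of the hvec x /\ vvec y is a copy of the tensor square of R over Q,
   and mixed is the projection onto it. *)
Definition mixed_wedge u v : ext2 'cV[R]_2 :=
  wedge2 (hvec (u 0 0)) (vvec (v 1 0)) - wedge2 (hvec (v 0 0)) (vvec (u 1 0)).
Definition mixed : ext2 'cV[R]_2 -> ext2 'cV[R]_2 := ext2_lift mixed_wedge.

Lemma mixed_wedgeDl u v w :
  mixed_wedge (u + v) w = mixed_wedge u w + mixed_wedge v w.
Proof. by rewrite /mixed_wedge !mxE !linearD /= wedge2Dl wedge2Dr opprD addrACA. Qed.

Lemma mixed_wedgeC u v : mixed_wedge u v = - mixed_wedge v u.
Proof. by rewrite /mixed_wedge opprB. Qed.

Lemma mixed_wedgeDr u v w :
  mixed_wedge u (v + w) = mixed_wedge u v + mixed_wedge u w.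
Proof. by rewrite mixed_wedgeC mixed_wedgeDl opprD -!mixed_wedgeC. Qed.

Lemma mixed_wedgeZ (q : rat) u v :
  mixed_wedge (ratr q *: u) v = mixed_wedge u (ratr q *: v).
Proof.
rewrite /mixed_wedge !mxE -![ratr q * _]/(ratr q *: (_ : R^o)).
by rewrite !linearZ /= !wedge2Z.
Qed.

Lemma mixed_wedgevv v : mixed_wedge v v = 0.
Proof. exact: subrr. Qed.

Lemma mixedD : {morph mixed : x y / x + y}.
Proof.
apply: ext2_liftD;
  [exact: mixed_wedgeDl|exact: mixed_wedgeDr|exact: mixed_wedgeZ|exact: mixed_wedgevv].
Qed.

Lemma mixedE u v : mixed (wedge2 u v) = mixed_wedge u v.
Proof.
apply: ext2_liftE;
  [exact: mixed_wedgeDl|exact: mixed_wedgeDr|exact: mixed_wedgeZ|exact: mixed_wedgevv].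
Qed.

(** This is the splitting of the exterior square of R + R into two copies of that of R and a tensor
    square. The first two parts vanish when the vertical and the horizontal direction are
    periodic. *)
Lemma ext2_decomposition z :
  z = ext2_map hvec (ext2_map (cross (vec2 0 1)) z)
    + ext2_map vvec (ext2_map (cross (vec2 1 0)) z) + mixed z.
Proof.
move: z; apply: ext2_eq_additive => [//|x y|u v].
  by rewrite !ext2_mapD mixedD [RHS]addrACA; congr (_ + _); exact: addrACA.
rewrite !ext2_map_wedge mixedE /= !crossE !(mul0r, mul1r, sub0r, subr0).
(* The form of (0, 1) is minus the first coordinate; the sign occurs in both factors and cancels. *)
rewrite !(linearN hvec) wedge2Nl wedge2Nr opprK.
have vE (w : 'cV[R]_2) : w = hvec (w 0 0) + vvec (w 1 0).
  by apply/matrixP; apply: ord2P => j; rewrite ord1 !mxE /= ?addr0 ?add0r.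
rewrite {1}(vE u) {1}(vE v) wedge2Dl !wedge2Dr /mixed_wedge.
rewrite [wedge2 (vvec _) (hvec _)]wedge2C.
by rewrite [RHS]addrACA; congr (_ + _); exact: addrC.
Qed.

(** An element fixed by [mixed] is a sum of wedges of a horizontal with a vertical vector, so only
    these need testing. *)
Lemma mixed_eq_additive (W : zmodType) (F G : ext2 'cV[R]_2 -> W) z :
  {morph F : x y / x + y} -> {morph G : x y / x + y} ->
  (forall x y, F (wedge2 (hvec x) (vvec y)) = G (wedge2 (hvec x) (vvec y))) ->
  mixed z = z -> F z = G z.
Proof.
move=> FD GD FG <-; move: z.
apply: (@ext2_eq_additive _ _ _ (F \o mixed) (G \o mixed)) => [x y|x y|u v] /=.
- by rewrite mixedD FD.
- by rewrite mixedD GD.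
(* The minus sign goes into the first factor, so that the second term is also a wedge of the tested
   form. *)
by rewrite mixedE /mixed_wedge -wedge2Nl -linearN FD GD !FG.
Qed.

Lemma hvec0 : hvec 0 = 0. Proof. exact: linear0. Qed.
Lemma vvec0 : vvec 0 = 0. Proof. exact: linear0. Qed.

Lemma mixed_wedge_hv (x y : R^o) :
  mixed (wedge2 (hvec x) (vvec y)) = wedge2 (hvec x) (vvec y).
Proof.
by rewrite mixedE /mixed_wedge !mxE /= hvec0 wedge20l subr0.
Qed.

(** * Diagonal matrices and the swap of coordinates on the tensor square *)

Local Notation diag a d := (mat2 a 0 0 d).
Local Notation swap := (mat2 0 1 1 0).

Lemma act_eq A B z : A = B -> act A z = act B z.
Proof. by move=> ->. Qed.

Lemma mat2_hvec (a b c d : R) (x : R^o) :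
  mat2 a b c d *m hvec x = hvec (a * x) + vvec (c * x).
Proof.
rewrite /hvec mat2_vec2 !mulr0 !addr0.
by apply/matrixP; apply: ord2P => j; rewrite !mxE /= ?addr0 ?add0r.
Qed.

Lemma mat2_vvec (a b c d : R) (x : R^o) :
  mat2 a b c d *m vvec x = hvec (b * x) + vvec (d * x).
Proof.
rewrite /vvec mat2_vec2 !mulr0 !add0r.
by apply/matrixP; apply: ord2P => j; rewrite !mxE /= ?addr0 ?add0r.
Qed.

Lemma act_diag_wedge (a d : R) (x y : R^o) :
  act (diag a d) (wedge2 (hvec x) (vvec y))
  = wedge2 (hvec (a * x)) (vvec (d * y)).
Proof.
by rewrite ext2_map_wedge /= mat2_hvec mat2_vvec !mul0r hvec0 vvec0 addr0 add0r.
Qed.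

Lemma mixed_act_diag (a d : R) z :
  mixed z = z -> mixed (act (diag a d) z) = act (diag a d) z.
Proof.
apply: (@mixed_eq_additive _ (fun z => mixed (act (diag a d) z))) => [x y|x y|x y].
- by rewrite ext2_mapD mixedD.
- exact: ext2_mapD.
by rewrite act_diag_wedge mixed_wedge_hv.
Qed.

(* x /\ y |-> x (x) y - y (x) x embeds the exterior square into the tensor
   square. *)
Definition antisym (x y : R^o) : ext2 'cV[R]_2 :=
  wedge2 (hvec x) (vvec y) - wedge2 (hvec y) (vvec x).

Lemma antisymDl x y t : antisym (x + y) t = antisym x t + antisym y t.
Proof. by rewrite /antisym !linearD /= wedge2Dl wedge2Dr opprD addrACA. Qed.

Lemma antisymDr x y t : antisym x (y + t) = antisym x y + antisym x t.
Proof. by rewrite /antisym !linearD /= wedge2Dl wedge2Dr opprD addrACA. Qed.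

Lemma antisymZ (q : rat) x y : antisym (ratr q *: x) y = antisym x (ratr q *: y).
Proof. by rewrite /antisym !linearZ /= !wedge2Z. Qed.

Lemma antisymvv x : antisym x x = 0.
Proof. exact: subrr. Qed.

(** On the tensor square, [swap] acts as minus the flip of the factors, so the right side says that
    [z] is a symmetric tensor. *)
Lemma cross11_eq0 z : mixed z = z ->
  ext2_map (cross (vec2 1 1)) z = 0 <-> act swap z = - z.
Proof.
move=> zmix; split=> [z0|zW].
  (* [antisym] applied to the projection along (1, 1) yields exactly [- (z + act swap z)], so the
     goal is brought to the vanishing of this. *)
  apply/eqP; rewrite -addr_eq0 addrC -oppr_eq0; apply/eqP.
  have aD := ext2_liftD antisymDl antisymDr antisymZ antisymvv.
  have aE := ext2_liftE antisymDl antisymDr antisymZ antisymvv.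
  have a0 : ext2_lift antisym 0 = 0.
    by apply: (addrI (ext2_lift antisym 0)); rewrite -aD !addr0.
  rewrite -[RHS]a0 -z0; move: zmix.
  apply: (@mixed_eq_additive _ (fun z => - (z + act swap z))
    (fun z => ext2_lift antisym (ext2_map (cross (vec2 1 1)) z))) => [x y|x y|x y].
  - by rewrite ext2_mapD -opprD addrACA.
  - by rewrite ext2_mapD aD.
  rewrite !ext2_map_wedge /= aE !crossE mat2_hvec mat2_vvec !mxE /=.
  rewrite !(mul0r, mul1r, mulr0) subr0 sub0r hvec0 vvec0 addr0 add0r.
  rewrite /antisym (linearN hvec) (linearN vvec) wedge2Nl wedge2Nr.
  by rewrite (wedge2C (vvec x)) -opprD.
(* [swap] negates the form of (1, 1), hence preserves the induced map on wedges, but it negates [z].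
   So the projection equals its own opposite. *)
apply: ext2_double_eq0.
have {1}<- : ext2_map (cross (vec2 1 1)) (act swap z) = ext2_map (cross (vec2 1 1)) z.
  rewrite (ext2_map_comp (k := cross (vec2 1 1) \o mulmx swap)) //.
  apply: ext2_map_opp => x /=.
  by rewrite (vec2E x) mat2_vec2 !crossE !mxE /=; ring.
by rewrite zW ext2_mapN addNr.
Qed.

(** * Periodic slopes of a symmetric tensor *)

Section NormalForm.
Context (z : ext2 'cV[R]_2) (zmix : mixed z = z) (zsym : act swap z = - z).

Definition tensor_slope (l : R) : Prop := act (diag l 1) z = act (diag 1 l) z.

Lemma vec2_neq0 (a b : R) : (a != 0) || (b != 0) -> vec2 a b != 0.
Proof.
move=> ab; apply/eqP => /matrixP e; have := e 0 0; have := e 1 0.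
by rewrite !mxE /= => b0 a0; rewrite a0 b0 eqxx in ab.
Qed.

(** The form of (1, l) is that of (1, 1) after [diag l 1], so [cross11_eq0] applies to the scaled
    tensor, even for l = 0. Moving [swap] past [diag l 1] turns it into [diag 1 l]. *)
Lemma cross1_eq0 (l : R) :
  ext2_map (cross (vec2 1 l)) z = 0 <-> tensor_slope l.
Proof.
rewrite -(@ext2_map_comp _ _ _ _ (cross (vec2 1 1)) (mulmx (diag l 1))); last first.
  by move=> x; rewrite (vec2E x) /= mat2_vec2 !crossE !mxE /=; ring.
rewrite cross11_eq0; last exact: mixed_act_diag.
have -> : act swap (act (diag l 1) z) = - act (diag 1 l) z.
  rewrite -ext2_mapN -zsym -!actM !mat2_mul; apply: act_eq.
  by congr mat2; ring.
by split=> [/oppr_inj|->].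
Qed.

Lemma periodic_slopeP (l : R) :
  periodic_direction z (vec2 1 l) <-> tensor_slope l.
Proof.
rewrite periodic_directionE cross1_eq0 vec2_neq0 ?oner_eq0 //.
by split=> [[]|].
Qed.

Lemma periodic_direction_vertical : periodic_direction z (vec2 0 1).
Proof.
apply/periodic_directionE; split; first by rewrite vec2_neq0 ?oner_eq0 ?orbT.
move: zmix; apply: (@mixed_eq_additive _ _ (fun=> 0)) => [||x y].
- exact: ext2_mapD.
- by move=> x y; rewrite addr0.
by rewrite ext2_map_wedge /= !crossE !mxE /= !mulr0 mul0r subr0 wedge20r.
Qed.

(** * Field operations on the slopes *)

Lemma tensor_slope1 : tensor_slope 1.
Proof. by []. Qed.

Lemma tensor_slopeD l m : tensor_slope l -> tensor_slope m -> tensor_slope (l + m).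
Proof.
have Dl : act (diag (l + m) 1) z = act (diag l 1) z + act (diag m 1) z.
  move: zmix; apply: (@mixed_eq_additive _ _
    (fun z => act (diag l 1) z + act (diag m 1) z)) => [||x y].
  - exact: ext2_mapD.
  - by move=> x y; rewrite !ext2_mapD addrACA.
  by rewrite !act_diag_wedge -wedge2Dl mulrDl linearD.
have Dr : act (diag 1 (l + m)) z = act (diag 1 l) z + act (diag 1 m) z.
  move: zmix; apply: (@mixed_eq_additive _ _
    (fun z => act (diag 1 l) z + act (diag 1 m) z)) => [||x y].
  - exact: ext2_mapD.
  - by move=> x y; rewrite !ext2_mapD addrACA.
  by rewrite !act_diag_wedge -wedge2Dr mulrDl linearD.
by rewrite /tensor_slope Dl Dr => -> ->.
Qed.

Lemma tensor_slopeN l : tensor_slope l -> tensor_slope (- l).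
Proof.
move=> Kl; rewrite /tensor_slope.
have -> : act (diag (- l) 1) z = - act (diag l 1) z.
  move: zmix; apply: (@mixed_eq_additive _ _ (fun z => - act (diag l 1) z)) => [||x y].
  - exact: ext2_mapD.
  - by move=> x y; rewrite ext2_mapD opprD.
  by rewrite !act_diag_wedge mulNr linearN wedge2Nl.
rewrite Kl; move: zmix.
apply: (@mixed_eq_additive _ (fun z => - act (diag 1 l) z)) => [||x y].
- by move=> x y; rewrite ext2_mapD opprD.
- exact: ext2_mapD.
by rewrite !act_diag_wedge mulNr linearN wedge2Nr.
Qed.

(** Scaling the left factor by [l] commutes with scaling the right one by [m]. *)
Lemma tensor_slopeM l m : tensor_slope l -> tensor_slope m -> tensor_slope (l * m).
Proof.
move=> Kl Km; rewrite /tensor_slope.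
have -> : act (diag (l * m) 1) z = act (diag 1 m) (act (diag l 1) z).
  have -> : act (diag (l * m) 1) z = act (diag l 1) (act (diag m 1) z).
    by rewrite -actM mat2_mul; apply: act_eq; congr mat2; ring.
  by rewrite Km -!actM !mat2_mul; apply: act_eq; congr mat2; ring.
by rewrite Kl -actM mat2_mul; apply: act_eq; congr mat2; ring.
Qed.

Lemma tensor_slopeV l : l != 0 -> tensor_slope l -> tensor_slope l^-1.
Proof.
move=> l0 Kl; rewrite /tensor_slope.
have -> : diag l^-1 1 = diag l^-1 l^-1 *m diag 1 l.
  by rewrite mat2_mul; congr mat2; field.
by rewrite actM -Kl -actM mat2_mul; apply: act_eq; congr mat2; field.
Qed.

Lemma tensor_slope_div l m : m != 0 ->
  tensor_slope l -> tensor_slope m -> tensor_slope (l / m).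
Proof. by move=> m0 Kl Km; apply: tensor_slopeM; last exact: tensor_slopeV. Qed.

(** * Shears, diagonal matrices and the inclusion of SL2 in the stabilizer *)

Lemma act_lower_shear l : tensor_slope l -> act (mat2 1 0 l 1) z = z.
Proof.
move/cross1_eq0 => z0.
(* The shear adds the wedge of [vvec (l * x)] and [vvec y]. This is minus the projection along slope
   [l] placed on the vertical axis, and that projection vanishes. *)
rewrite -[RHS]subr0 -(ext2_map0 vvec) -z0; move: zmix.
apply: (@mixed_eq_additive _ _
  (fun z => z - ext2_map vvec (ext2_map (cross (vec2 1 l)) z))) => [||x y].
- exact: ext2_mapD.
- by move=> x y; rewrite !ext2_mapD opprD addrACA.
rewrite !ext2_map_wedge /= !crossE mat2_hvec mat2_vvec !mxE /=.
rewrite !(mul0r, mul1r, mulr0) subr0 sub0r hvec0 add0r.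
by rewrite (linearN vvec) wedge2Nl opprK wedge2Dl.
Qed.

Lemma act_upper_shear l : tensor_slope l -> act (mat2 1 l 0 1) z = z.
Proof.
move=> Kl; have -> : mat2 1 l 0 1 = swap *m (mat2 1 0 l 1 *m swap).
  by rewrite !mat2_mul; congr mat2; ring.
by rewrite !actM zsym !ext2_mapN act_lower_shear // zsym opprK.
Qed.

(** Both sides of the first equation are composed with the invertible matrix [diag 1 a]. *)
Lemma act_diagV (a : R) : a != 0 ->
  act (diag a a^-1) z = z <-> tensor_slope a.
Proof.
move=> a0; rewrite /tensor_slope.
have <- : act (diag 1 a) (act (diag a a^-1) z) = act (diag a 1) z.
  by rewrite -actM mat2_mul; apply: act_eq; congr mat2; field.
split=> [->//|/(congr1 (act (diag 1 a^-1)))].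
have iK (x : ext2 'cV[R]_2) : act (diag 1 a^-1) (act (diag 1 a) x) = x.
  by rewrite -actM mat2_mul -[RHS]act1 -mat2_1; apply: act_eq; congr mat2; field.
by rewrite !iK.
Qed.

Lemma act_rotation : act (mat2 0 1 (-1) 0) z = z.
Proof.
have -> : mat2 0 1 (-1) 0 = mat2 1 1 0 1 *m (mat2 1 0 (-1) 1 *m mat2 1 1 0 1).
  by rewrite !mat2_mul; congr mat2; ring.
have K1 := tensor_slope1; have KN1 := tensor_slopeN K1.
by rewrite !actM !(act_upper_shear K1) (act_lower_shear KN1) act_upper_shear.
Qed.

(** The rotation moves the second row to the top, so the upper left entry may be assumed nonzero
    below. *)
Lemma act_rotation_mul A : act (mat2 0 1 (-1) 0 *m A) z = z <-> act A z = z.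
Proof.
rewrite actM; split=> [e|->]; last exact: act_rotation.
have u : mat2 0 1 (-1) 0 \in unitmx.
  by rewrite unitmxE det_mat2 mul0r mul1r opprK add0r unitr1.
by rewrite -[LHS](actK _ u) e -{1}act_rotation actK.
Qed.

Lemma act_SL2 (a b c d : R) :
  a * d - b * c = 1 -> tensor_slope a -> tensor_slope b -> tensor_slope c ->
  tensor_slope d -> act (mat2 a b c d) z = z.
Proof.
wlog a0 : a b c d / a != 0 => [wlg|] det1 Ka Kb Kc Kd.
  have [a0|/wlg] := eqVneq a 0; last exact.
  apply/act_rotation_mul; rewrite mat2_mul !mul0r !mul1r !mulN1r !add0r !addr0.
  apply: wlg => //; [|by rewrite -det1; ring|exact: tensor_slopeN..].
  apply: contra_eq_neq det1 => ->; rewrite a0 mul0r mulr0 subrr.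
  by rewrite eq_sym oner_eq0.
(* LDU decomposition with pivot [a]; the determinant condition determines [d]. *)
have -> : mat2 a b c d
    = mat2 1 0 (c / a) 1 *m (diag a a^-1 *m mat2 1 (b / a) 0 1).
  rewrite !mat2_mul; have -> : d = (1 + b * c) / a by rewrite -det1; field.
  by congr mat2; field.
rewrite !actM act_upper_shear ?(proj2 (act_diagV a0)) //; last exact: tensor_slope_div.
by apply: act_lower_shear; exact: tensor_slope_div.
Qed.

(** * Entries of a matrix that fixes the tensor *)

Lemma SL2_of_act (a b c d : R) :
  a * d - b * c = 1 -> act (mat2 a b c d) z = z ->
  [/\ tensor_slope a, tensor_slope b, tensor_slope c & tensor_slope d].
Proof.
wlog a0 : a b c d / a != 0 => [wlg|] det1 Az.
  have [a0|/wlg] := eqVneq a 0; last exact.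
  move/act_rotation_mul: Az; rewrite mat2_mul !mul0r !mul1r !mulN1r !add0r !addr0.
  move/wlg; case=> [||Kc Kd /tensor_slopeN Ka /tensor_slopeN Kb].
  - apply: contra_eq_neq det1 => ->; rewrite a0 mul0r mulr0 subrr.
    by rewrite eq_sym oner_eq0.
  - by rewrite -det1; ring.
  by rewrite !opprK in Ka Kb.
(* A matrix fixing [z] preserves its periodic directions; its columns are the images of the
   horizontal and vertical ones. *)
have perA v : periodic_direction z v -> periodic_direction z (mat2 a b c d *m v).
  by rewrite -{2}Az periodic_direction_act // unitmxE det_mat2 det1 unitr1.
have K0 : tensor_slope 0.
  by rewrite -(subrr 1); apply: tensor_slopeD; last exact: tensor_slopeN.
have Kca : tensor_slope (c / a).
  apply/periodic_slopeP/(periodic_directionZ _ _ a0).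
  have -> : a *: vec2 1 (c / a) = mat2 a b c d *m vec2 1 0.
    rewrite mat2_vec2; apply/matrixP; apply: ord2P => j; rewrite !mxE /=; by field.
  exact/perA/periodic_slopeP.
have Kab : tensor_slope (a * b).
  have [->|b0] := eqVneq b 0; first by rewrite mulr0.
  have Kdb : tensor_slope (d / b).
    apply/periodic_slopeP/(periodic_directionZ _ _ b0).
    have -> : b *: vec2 1 (d / b) = mat2 a b c d *m vec2 0 1.
      rewrite mat2_vec2; apply/matrixP; apply: ord2P => j; rewrite !mxE /=; by field.
    exact/perA/periodic_direction_vertical.
  (* The column slopes d/b and c/a differ by 1/(ab), since the determinant is 1. *)
  have -> : a * b = (d / b - c / a)^-1.
    rewrite -[LHS]invrK; congr (_^-1); rewrite -[LHS]mul1r -det1; field.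
    by rewrite a0 b0.
  apply: tensor_slopeV; last by apply: tensor_slopeD; last exact: tensor_slopeN.
  have -> : d / b - c / a = (a * b)^-1.
    rewrite -[RHS]mul1r -det1; field; by rewrite a0 b0.
  by rewrite invr_eq0 mulf_neq0.
have Ka : tensor_slope a.
  apply/act_diagV => //.
  (* The diagonal factor stands rightmost in the decomposition, so the upper shear has parameter ab,
     already known to be a slope, instead of b/a. *)
  have -> : diag a a^-1
      = mat2 1 (- (a * b)) 0 1 *m (mat2 1 0 (- (c / a)) 1 *m mat2 a b c d).
    rewrite !mat2_mul; have -> : d = (1 + b * c) / a by rewrite -det1; field.
    by congr mat2; field.
  by rewrite !actM Az act_lower_shear ?act_upper_shear //; exact: tensor_slopeN.
have Kb : tensor_slope b by rewrite -[b](mulKf a0) mulrC; exact: tensor_slope_div.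
have Kc : tensor_slope c by rewrite -[c](divfK a0); exact: tensor_slopeM.
split=> //; have -> : d = (1 + b * c) / a by rewrite -det1; field.
apply: tensor_slope_div => //; apply: tensor_slopeD => //; exact: tensor_slopeM.
Qed.

End NormalForm.

(** * Return to arbitrary coordinates *)

Lemma det_conjmx g A B : g \in unitmx -> A = g *m B *m invmx g -> \det A = \det B.
Proof.
move=> gu ->; rewrite !det_mulmx det_inv mulrC mulrA mulVf ?mul1r //.
by rewrite -unitfE -unitmxE.
Qed.

Lemma Iso_conj_SL2 z (K : set R) : is_periodic_direction_field z K ->
  exists2 g : 'M[R]_2, g \in unitmx &
    Iso z = [set g *m A *m invmx g | A in SL2 K].
Proof.
case=> g [gu s0 s1 sv] ->; exists (invmx g); first by rewrite unitmx_inv.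
(* The matrix [g] carries [z] to its normal form [act g z], so [invmx g] is the conjugating
   element. *)
have per v : periodic_direction z (invmx g *m v)
    <-> periodic_direction (act g z) v.
  by rewrite -(periodic_direction_act _ _ gu) mulKVmx.
have /periodic_directionE[_ z0] := (per _).1 s0.
have /periodic_directionE[_ z1] := (per _).1 s1.
have /periodic_directionE[_ zv] := (per _).1 sv.
(* Slopes 0 and infinity remove the two pure parts; slope 1 then gives the symmetry [zsym]. *)
have zmix : mixed (act g z) = act g z.
  by rewrite [RHS]ext2_decomposition [X in ext2_map hvec X]zv
    [X in ext2_map vvec X]z0 !ext2_map0 !add0r.
have zsym : act swap (act g z) = - act g z by apply/cross11_eq0.
have KP l : periodic_slopes z g l <-> tensor_slope (act g z) l.
  by apply: iff_trans (periodic_slopeP zmix zsym l); exact: per.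
rewrite invmxK; apply/seteqP; split=> [A [[_ det1] Az]|_ [B [KB det1] <-]] /=.
  exists (g *m A *m invmx g); last by rewrite !mulmxA mulVmx // mul1mx mulmxKV.
  have detB : \det (g *m A *m invmx g) = 1 by rewrite (det_conjmx gu erefl).
  have Bz : act (g *m A *m invmx g) (act g z) = act g z.
    by rewrite !actM actK // Az.
  split=> //; move: (_ *m _) detB Bz => B.
  rewrite (mat2E B) det_mat2 => detB Bz.
  have [K00 K01 K10 K11] := SL2_of_act zmix zsym detB Bz.
  by apply: ord2P; apply: ord2P; rewrite !mxE /=; apply/KP.
split; first split=> //.
  by rewrite -det1; apply: (@det_conjmx (invmx g)); rewrite ?unitmx_inv ?invmxK.
rewrite !actM; have -> : act B (act g z) = act g z; last exact: actK.
rewrite (mat2E B).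
apply: act_SL2 => //; try exact/KP.
by rewrite -det_mat2 -mat2E.
Qed.

End Plane.

Theorem theorem1p12 (R : realType) (S : translation_surface R)
    (T : triangulation S) (K : set R) :
  algebraically_periodic (J_invariant T) ->
  is_periodic_direction_field (J_invariant T) K ->
  exists2 g : 'M[R]_2, g \in unitmx &
    Iso (J_invariant T) = [set g *m A *m invmx g | A in SL2 K].
Proof. by move=> _; exact: Iso_conj_SL2. Qed.
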